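(* Let $m\le M$ be real numbers and let $c\in[m,M]$. For each integer $n\ge 1$ put $$V_n=\max\{\mathrm{var}(x) : x\in[m,M]^n,\ \bar{x}=c\}.$$ Then $V_n$ approaches $(M-c)(c-m)$ from below as $n\to\infty$; that is, $V_n\le (M-c)(c-m)$ for every $n\ge 1$, and $\lim_{n\to\infty}V_n=(M-c)(c-m)$.
   Context: For a dataset $x=(x_1,\ldots,x_n)\in\mathbb{R}^n$, the mean is $\bar{x}=\frac{1}{n}\sum_{i=1}^n x_i$ and the variance is $\mathrm{var}(x)=\frac{1}{n}\sum_{i=1}^n (x_i-\bar{x})^2=\frac{1}{n}\sum_{i=1}^n x_i^2-\bar{x}^2$. *)

(* Defs.v *)
(* MathComp-Analysis: real numbers are an arbitrary [R : realType] *)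
From HB Require Import structures.
From mathcomp Require Import all_boot all_order all_algebra.
From mathcomp Require Import all_classical all_reals all_analysis.

Set Implicit Arguments.
Unset Strict Implicit.
Unset Printing Implicit Defensive.

Import Order.TTheory GRing.Theory Num.Theory.
Import numFieldNormedType.Exports.

Local Open Scope classical_set_scope.
Local Open Scope ring_scope.

Definition mean (R : realType) (n : nat) (x : 'rV[R]_n) : R :=
  n%:R^-1 * \sum_(i < n) x ord0 i.

Definition var (R : realType) (n : nat) (x : 'rV[R]_n) : R :=
  n%:R^-1 * \sum_(i < n) (x ord0 i - mean x) ^+ 2.

Definition variances (R : realType) (m M c : R) (n : nat) : set R :=
  [set var x | x in [set x : 'rV[R]_n |
     (forall i, m <= x ord0 i <= M) /\ mean x = c]].

(* [v = max A]: unlike [sup A], the maximum has to be attained *)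
Definition is_max (R : realType) (A : set R) (v : R) : Prop :=
  A v /\ ubound A v.

(* Main.v *)
Require Import Defs.
From HB Require Import structures.
From mathcomp Require Import all_boot all_order all_algebra.
From mathcomp Require Import all_classical all_reals all_analysis.
From mathcomp Require Import ring lra.
Import Order.TTheory GRing.Theory Num.Theory.
Import numFieldNormedType.Exports.
Local Open Scope classical_set_scope.
Local Open Scope ring_scope.

(** Expanding squares, a dataset [x] in [m, M]^n with mean [c] satisfies
      var x = (M - c)(c - m) - (1/n) sum_i (M - x_i)(x_i - m),
    and the sum subtracted here, the defect, is nonnegative.  Maximising the
    variance therefore means minimising the defect.  In the coordinates
    y_i = (x_i - m) / (M - m), which lie in [0, 1] and have the fixed sum
    s = n (c - m) / (M - m), the defect is (M - m)^2 sum_i y_i (1 - y_i).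

    Let g s = {s} (1 - {s}), with {s} the fractional part of s.  This function
    is subadditive against points of the unit interval:
    g (s + y) <= g s + y (1 - y) for y in [0, 1] ([frac_parabola_subadd]).  By
    induction sum_i y_i (1 - y_i) >= g (sum_i y_i), and equality holds for the
    greedy choice that fills the coordinates one after the other up to 1 until
    the total s is exhausted ([sum_fill_parabola]).  Hence
      V_n = (M - c)(c - m) - (1/n) (M - m)^2 g s        ([is_max_variances]),
    and since 0 <= g <= 1 the correction is nonnegative and is O(1/n).

    When m = M the convention 0^-1 = 0 makes all y_i and s vanish, and
    x_i = m + (M - m) y_i remains true because x_i = m is forced; so the
    formula for V_n covers this case too. *)

(** * The parabola of the fractional part *)

Definition frac_parabola {R : realType} (s : R) : R :=
  (s - (Num.floor s)%:~R) * (1 - (s - (Num.floor s)%:~R)).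

(** Allowing the right end [k + 1] is harmless because [t (1 - t)] vanishes at
    both ends of the unit interval. *)
Lemma frac_parabolaE {R : realType} (s : R) (k : int) :
  k%:~R <= s <= k%:~R + 1 ->
  frac_parabola s = (s - k%:~R) * (1 - (s - k%:~R)).
Proof.
case/andP=> ks sk; rewrite /frac_parabola.
have [sk1|sk1] := ltP s (k%:~R + 1).
  by rewrite (@floor_def _ s k) // ks intrD.
have -> : s = (k + 1)%:~R by apply/eqP; rewrite eq_le intrD sk sk1.
by rewrite intrKfloor intrD; ring.
Qed.

Lemma frac_parabola_itv {R : realType} (s : R) : 0 <= frac_parabola s <= 1.
Proof.
have /andP[] := floor_itv s; rewrite /frac_parabola intrD.
by set f := _%:~R => fs sf; nra.
Qed.

Lemma frac_parabola_nat {R : realType} (k : nat) : frac_parabola (k%:R : R) = 0.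
Proof.
rewrite (@frac_parabolaE R _ k%:Z) -?pmulrn ?lexx ?lerDl ?ler01 //.
by rewrite subrr mul0r.
Qed.

(** With [a] the fractional part of [s], the right side exceeds the left one by
    [2 a y] if [a + y] stays below 1, and by [2 (1 - a) (1 - y)] if it wraps
    around. *)
Lemma frac_parabola_subadd {R : realType} (s y : R) : 0 <= y <= 1 ->
  frac_parabola (s + y) <= frac_parabola s + y * (1 - y).
Proof.
case/andP=> y0 y1; have /andP[] := floor_itv s; rewrite intrD => fs sf.
rewrite {2}/frac_parabola.
have [wrap|wrap] := leP (s + y) ((Num.floor s)%:~R + 1).
  rewrite (@frac_parabolaE _ _ (Num.floor s)); last by rewrite wrap andbT; lra.
  by move: fs sf; set f := _%:~R => fs sf; nra.
rewrite (@frac_parabolaE _ _ (Num.floor s + 1)); last first.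
  by rewrite intrD (ltW wrap); lra.
by rewrite intrD; move: fs sf; set f := _%:~R => fs sf; nra.
Qed.

Lemma frac_parabola_sum {R : realType} (n : nat) (y : 'I_n -> R) :
  (forall i, 0 <= y i <= 1) ->
  frac_parabola (\sum_i y i) <= \sum_i y i * (1 - y i).
Proof.
elim: n y => [|n IHn] y y01; first by rewrite !big_ord0 (frac_parabola_nat 0).
rewrite !big_ord_recr /=; apply: le_trans (frac_parabola_subadd _ _ (y01 _)) _.
by rewrite lerD2r; apply: IHn.
Qed.

(** * The greedy filling *)

(** The part of [s] that falls in the [i]-th unit cell [i, i + 1]; written as
    a difference so that sums over [i] telescope. *)
Definition fill {R : realType} (s : R) (i : nat) : R :=
  Num.min s i.+1%:R - Num.min s i%:R.

Lemma fill_itv {R : realType} (s : R) (i : nat) : 0 <= fill s i <= 1.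
Proof.
rewrite /fill -natr1; case: (leP s i%:R) => si; case: (leP s (i%:R + 1)) => si1;
  by apply/andP; split; lra.
Qed.

Lemma sum_fill {R : realType} (s : R) (n : nat) : 0 <= s <= n%:R ->
  \sum_(i < n) fill s i = s.
Proof.
case/andP=> s0 sn.
rewrite -(big_mkord predT (fill s)).
rewrite (telescope_sumr (fun i => Num.min s i%:R)) //.
by rewrite (min_idPl sn) (min_idPr s0) subr0.
Qed.

(** Only the cell that contains [s] is partially filled, so the defect
    telescopes as well. *)
Lemma fill_parabola {R : realType} (s : R) (i : nat) :
  fill s i * (1 - fill s i) =
  frac_parabola (Num.min s i.+1%:R) - frac_parabola (Num.min s i%:R).
Proof.
rewrite /fill.
have [si|si] := leP s i%:R.
  rewrite min_l; last by rewrite -natr1; lra.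
  by ring.
have [si1|si1] := leP s i.+1%:R; rewrite !frac_parabola_nat.
  rewrite (@frac_parabolaE _ s i%:Z) -?pmulrn ?subr0 //.
  by rewrite natr1 si1 (ltW si).
by rewrite -natr1; ring.
Qed.

Lemma sum_fill_parabola {R : realType} (s : R) (n : nat) : 0 <= s <= n%:R ->
  \sum_(i < n) fill s i * (1 - fill s i) = frac_parabola s.
Proof.
case/andP=> s0 sn.
rewrite -(big_mkord predT (fun i => fill s i * (1 - fill s i))).
under eq_bigr do rewrite fill_parabola.
rewrite (telescope_sumr (fun i => frac_parabola (Num.min s i%:R))) //.
by rewrite (min_idPl sn) (min_idPr s0) (frac_parabola_nat 0) subr0.
Qed.

(** * The maximal variance *)

Lemma var_defect {R : realType} (m M : R) (n : nat) (x : 'rV[R]_n) :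
  (0 < n)%N ->
  var x = (M - mean x) * (mean x - m)
          - n%:R^-1 * \sum_(i < n) (M - x ord0 i) * (x ord0 i - m).
Proof.
move=> n0; have nN0 : n%:R != 0 :> R by rewrite pnatr_eq0 -lt0n.
have sumE : \sum_(i < n) x ord0 i = n%:R * mean x by rewrite /mean mulVKf.
rewrite /var; set c := mean x in sumE *.
(* termwise the two sums differ by an expression affine in [x_i] *)
have -> : \sum_(i < n) (x ord0 i - c) ^+ 2 =
    \sum_(i < n) ((M + m - 2 * c) * x ord0 i + (c ^+ 2 - M * m))
    - \sum_(i < n) (M - x ord0 i) * (x ord0 i - m).
  by rewrite -sumrB; apply: eq_bigr => i _; ring.
rewrite big_split /= -mulr_sumr sumE sumr_const card_ord -[_ *+ n]mulr_natl.
by field.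
Qed.

Definition max_variance {R : realType} (m M c : R) (n : nat) : R :=
  (M - c) * (c - m)
  - n%:R^-1 * ((M - m) ^+ 2 * frac_parabola (n%:R * ((c - m) / (M - m)))).

(** If [m = M], division by zero makes the coordinate [0], and this is still
    the coordinate of the only admissible value [c = m]. *)
Lemma unit_coordK {R : realType} (m M c : R) : m <= c <= M ->
  m + (M - m) * ((c - m) / (M - m)) = c.
Proof.
case/andP=> mc cM; have [Mm|Mm] := eqVneq (M - m) 0.
  by rewrite Mm mul0r addr0; apply/eqP; rewrite eq_le mc /=; lra.
by field.
Qed.

Lemma unit_coord_itv {R : realType} (m M c : R) : m <= c <= M ->
  0 <= (c - m) / (M - m) <= 1.
Proof.
case/andP=> mc cM; have [Mm|Mm] := leP (M - m) 0.
  have -> : M - m = 0 by apply/eqP; rewrite eq_le Mm /=; lra.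
  by rewrite invr0 mulr0 lexx ler01.
by rewrite divr_ge0 ?ler_pdivrMr ?mul1r //=; lra.
Qed.

Lemma sum_defect_scale {R : realType} (m M : R) (n : nat) (x y : 'I_n -> R) :
  (forall i, x i = m + (M - m) * y i) ->
  \sum_i (M - x i) * (x i - m) = (M - m) ^+ 2 * \sum_i y i * (1 - y i).
Proof.
by move=> xE; rewrite mulr_sumr; apply: eq_bigr => i _; rewrite xE; ring.
Qed.

(** The greedy filling of the total [n (c - m) / (M - m)] attains the bound that
    [frac_parabola_sum] sets on the defect: all entries equal [m] or [M], with
    at most one exception. *)
Lemma is_max_variances {R : realType} (m M c : R) (n : nat) :
  m <= c <= M -> (0 < n)%N ->
  is_max (variances m M c n) (max_variance m M c n).
Proof.
move=> hc n0; have nN0 : n%:R != 0 :> R by rewrite pnatr_eq0 -lt0n.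
have /andP[p0 p1] := unit_coord_itv m M c hc.
split.
  set s : R := n%:R * ((c - m) / (M - m)).
  have s_itv : 0 <= s <= n%:R by rewrite mulr_ge0 //= ler_piMr.
  pose x : 'rV[R]_n := \row_i (m + (M - m) * fill s i).
  have xE i : x ord0 i = m + (M - m) * fill s i by rewrite mxE.
  have meanx : mean x = c.
    rewrite /mean (eq_bigr _ (fun i _ => xE i)) big_split /= -mulr_sumr.
    rewrite sum_fill // sumr_const card_ord -[m *+ n]mulr_natl.
    rewrite -[RHS](unit_coordK m M c hc) /s mulrDr mulKf //.
    by rewrite (mulrCA (M - m) n%:R) mulKf.
  exists x.
    split=> // i; rewrite xE; have /andP[f0 f1] := fill_itv s i.
    by case/andP: hc => mc cM; nra.
  rewrite (var_defect m M) // meanx (sum_defect_scale m M n _ _ xE).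
  by rewrite sum_fill_parabola.
move=> _ [x [x_itv meanx] <-].
pose y i := (x ord0 i - m) / (M - m).
have xE i : x ord0 i = m + (M - m) * y i by rewrite unit_coordK.
rewrite (var_defect m M) // meanx (sum_defect_scale m M n _ _ xE).
rewrite /max_variance.
have <- : \sum_i y i = n%:R * ((c - m) / (M - m)).
  rewrite -mulr_suml sumrB sumr_const card_ord -[m *+ n]mulr_natl -meanx.
  by rewrite /mean mulrA mulrBr mulVKf.
rewrite lerD2l lerN2 ler_wpM2l ?invr_ge0 // ler_wpM2l ?sqr_ge0 //.
by apply: frac_parabola_sum => i; apply: unit_coord_itv.
Qed.

Lemma is_max_unique {R : realType} (A : set R) (v w : R) :
  is_max A v -> is_max A w -> v = w.
Proof.
by case=> Av ubv [Aw ubw]; apply/eqP; rewrite eq_le ubw // ubv.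
Qed.

Lemma max_variance_itv {R : realType} (m M c : R) (n : nat) :
  (M - c) * (c - m) - n%:R^-1 * (M - m) ^+ 2 <= max_variance m M c n
    <= (M - c) * (c - m).
Proof.
have /andP[g0 g1] := frac_parabola_itv (n%:R * ((c - m) / (M - m))).
rewrite /max_variance; apply/andP; split.
  by rewrite lerD2l lerN2 ler_wpM2l ?invr_ge0 // ler_piMr ?sqr_ge0.
by rewrite gerBl mulr_ge0 ?invr_ge0 // mulr_ge0 ?sqr_ge0.
Qed.

Theorem corollary2 (R : realType) (m M c : R) (hmM : m <= M)
    (hc : m <= c <= M) :
  (forall n : nat, (1 <= n)%N -> exists v : R, is_max (variances m M c n) v) /\
  (forall V : nat -> R,
     (forall n : nat, (1 <= n)%N -> is_max (variances m M c n) (V n)) ->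
     (forall n : nat, (1 <= n)%N -> V n <= (M - c) * (c - m)) /\
     V n @[n --> \oo] --> (M - c) * (c - m)).
Proof.
split=> [n n1|V maxV].
  by exists (max_variance m M c n); apply: is_max_variances.
have VE n : (1 <= n)%N -> V n = max_variance m M c n.
  by move=> n1; apply: is_max_unique (maxV n n1) _; apply: is_max_variances.
split=> [n n1|].
  by rewrite VE //; case/andP: (max_variance_itv m M c n).
apply: (@squeeze_cvgr _ _ _ _
    (fun n : nat => (M - c) * (c - m) - n%:R^-1 * (M - m) ^+ 2)
    (fun=> (M - c) * (c - m))).
- near=> n; rewrite VE; first exact: max_variance_itv.
  by near: n; exact: nbhs_infty_ge.
- rewrite -[X in _ --> X]subr0 -(mul0r ((M - m) ^+ 2)).
  apply: cvgB; first exact: cvg_cst.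
  (* the harmonic sequence starts with 1 / 1, hence the shift *)
  apply: cvgMl; rewrite -cvg_shiftS.
  exact: cvg_harmonic.
- exact: cvg_cst.
Unshelve. all: by end_near.
Qed.
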